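(* Let $\mathcal A$ be an abelian category and let $\mathcal X\subseteq\mathcal G\subseteq\mathcal A$ be two classes of objects, and $\mathcal Y,\mathcal H$ classes of objects of $\mathcal A$, such that: 1. $(\mathcal X,\mathcal Y)$ is a complete hereditary cotorsion pair. 2. $(\mathcal G,\mathcal H,\mathcal X\cap\mathcal Y)$ is a left AB-context. Then $(\mathcal G,\widehat{\mathcal X},\mathcal Y)$ is a hereditary Hovey triple.
   Context: Classes of objects are identified with full subcategories closed under isomorphisms. For a class $\mathcal X$, $\mathcal X^\perp=\{M \mid \mathrm{Ext}^1_{\mathcal A}(X,M)=0\ \forall X\in\mathcal X\}$ and ${}^\perp\mathcal X=\{M \mid \mathrm{Ext}^1_{\mathcal A}(M,X)=0\ \forall X\in\mathcal X\}$. A cotorsion pair is a pair $(\mathcal X,\mathcal Y)$ with $\mathcal X^\perp=\mathcal Y$ and $\mathcal X={}^\perp\mathcal Y$; it is hereditary if $\mathrm{Ext}^i_{\mathcal A}(X,Y)=0$ for all $X\in\mathcal X$, $Y\in\mathcal Y$, $i\ge1$; it is complete if for every $A\in\mathcal A$ there are short exact sequences $0\to Y\to X\to A\to0$ and $0\to A\to Y'\to X'\to0$ with $X,X'\in\mathcal X$, $Y,Y'\in\mathcal Y$. $\widehat{\mathcal X}$ is the class of objects $A$ admitting an exact sequence $0\to X_n\to\cdots\to X_0\to A\to0$ for some $n\ge 0$ with all $X_i\in\mathcal X$. A class is left (resp. right) thick if it is closed under extensions, direct summands, and kernels of epimorphisms (resp. cokernels of monomorphisms); it is thick if it is left and right thick.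 A class $\omega$ is a cogenerator for $\mathcal X$ if $\omega\subseteq\mathcal X$ and for every $X\in\mathcal X$ there is an exact sequence $0\to X\to W\to X'\to0$ with $W\in\omega$ and $X'\in\mathcal X$; it is an injective cogenerator for $\mathcal X$ if moreover $\mathrm{Ext}^i_{\mathcal A}(X,W)=0$ for all $X\in\mathcal X$, $W\in\omega$, $i\ge1$. A triple $(\mathcal X,\mathcal Y,\omega)$ is a left weak AB-context (Auslander–Buchweitz context) if: (AB1) $\mathcal X$ is left thick; (AB2) $\mathcal Y$ is right thick and $\mathcal Y\subseteq\widehat{\mathcal X}$; (AB3) $\omega=\mathcal X\cap\mathcal Y$ and $\omega$ is an injective cogenerator for $\mathcal X$. It is a left AB-context if moreover $\widehat{\mathcal X}=\mathcal A$. A Hovey triple is a triple $(\mathcal Q,\mathcal W,\mathcal R)$ such that $\mathcal W$ is thick and $(\mathcal Q,\mathcal W\cap\mathcal R)$ and $(\mathcal Q\cap\mathcal W,\mathcal R)$ are complete cotorsion pairs; it is hereditary if both of these cotorsion pairs are hereditary. *)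

(* Defs.v *)
From mathcomp Require Import all_boot all_algebra.
From mathcomp Require Import boolp classical_sets.
From Stdlib Require Import Relations.Relation_Operators.

Set Implicit Arguments.
Unset Strict Implicit.
Unset Printing Implicit Defensive.

Import GRing.Theory.
Local Open Scope ring_scope.
Local Open Scope classical_set_scope.

(* Hom-groups are zmodTypes; the decidable equality and choice operator this
   includes exist on every type classically (boolp), so nothing is lost. *)
Record preadditive : Type := Preadditive {
  obj :> Type;
  hom : obj -> obj -> zmodType;
  idm : forall X : obj, hom X X;
  comp : forall X Y Z : obj, hom Y Z -> hom X Y -> hom X Z;
  compA : forall (X Y Z T : obj) (h : hom Z T) (g : hom Y Z) (f : hom X Y),
    comp h (comp g f) = comp (comp h g) f;
  comp1m : forall (X Y : obj) (f : hom X Y), comp (idm Y) f = f;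
  compm1 : forall (X Y : obj) (f : hom X Y), comp f (idm X) = f;
  compDl : forall (X Y Z : obj) (g g' : hom Y Z) (f : hom X Y),
    comp (g + g') f = comp g f + comp g' f;
  compDr : forall (X Y Z : obj) (g : hom Y Z) (f f' : hom X Y),
    comp g (f + f') = comp g f + comp g f' }.

Arguments idm {p} X.

Notation "g \oc f" := (comp g f) (at level 40, left associativity).

Section Preadditive.
Variable A : preadditive.
Implicit Types X Y Z K E : A.

Definition is_mono X Y (f : hom X Y) : Prop :=
  forall Z (u v : hom Z X), f \oc u = f \oc v -> u = v.

Definition is_epi X Y (f : hom X Y) : Prop :=
  forall Z (u v : hom Y Z), u \oc f = v \oc f -> u = v.

Definition is_iso X Y (f : hom X Y) : Prop :=
  exists g : hom Y X, g \oc f = idm X /\ f \oc g = idm Y.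

Definition is_zero Z : Prop :=
  (forall X (f : hom X Z), f = 0) /\ (forall X (f : hom Z X), f = 0).

Definition is_biproduct X Y Z (i : hom X Z) (j : hom Y Z)
    (p : hom Z X) (q : hom Z Y) : Prop :=
  [/\ p \oc i = idm X, q \oc j = idm Y, p \oc j = 0, q \oc i = 0
    & i \oc p + j \oc q = idm Z].

Definition is_kernel K X Y (k : hom K X) (f : hom X Y) : Prop :=
  f \oc k = 0 /\
  forall Z (g : hom Z X), f \oc g = 0 -> exists! u : hom Z K, k \oc u = g.

Definition is_cokernel X Y K (c : hom Y K) (f : hom X Y) : Prop :=
  c \oc f = 0 /\
  forall Z (g : hom Y Z), g \oc f = 0 -> exists! u : hom K Z, u \oc c = g.

Record is_abelian : Prop := IsAbelian {
  has_zero : exists Z, is_zero Z;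
  has_biproducts : forall X Y, exists Z (i : hom X Z) (j : hom Y Z)
    (p : hom Z X) (q : hom Z Y), is_biproduct i j p q;
  has_kernels : forall X Y (f : hom X Y), exists K (k : hom K X), is_kernel k f;
  has_cokernels :
    forall X Y (f : hom X Y), exists K (c : hom Y K), is_cokernel c f;
  mono_normal : forall X Y (f : hom X Y), is_mono f ->
    exists Z (g : hom Y Z), is_kernel f g;
  epi_normal : forall X Y (f : hom X Y), is_epi f ->
    exists Z (g : hom Z X), is_cokernel f g }.

Definition iso_closed (P : set A) : Prop :=
  forall X Y (f : hom X Y), is_iso f -> P X -> P Y.

(* Exactness at Y: the image of f is the kernel of g. *)
Definition exact X Y Z (f : hom X Y) (g : hom Y Z) : Prop :=
  exists I (e : hom X I) (m : hom I Y),
    [/\ is_epi e, is_kernel m g & f = m \oc e].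

Definition short_exact X Y Z (f : hom X Y) (g : hom Y Z) : Prop :=
  [/\ is_mono f, exact f g & is_epi g].

(* chain n Y X is the type of diagrams Y -> E_n -> ... -> E_1 -> X with n
   intermediate objects. *)
Fixpoint chain (n : nat) (Y X : A) : Type :=
  match n with
  | 0 => hom Y X
  | n'.+1 => {E : A & (hom Y E * chain n' E X)%type}
  end.

Fixpoint exact_after (n : nat) (Z Y X : A) (f : hom Z Y) {struct n} :
    chain n Y X -> Prop :=
  match n with
  | 0 => fun g => exact f g /\ is_epi g
  | n'.+1 => fun c =>
      exact f (projT2 c).1 /\ exact_after (projT2 c).1 (projT2 c).2
  end.

(* 0 -> Y -> E_n -> ... -> E_1 -> X -> 0 is exact. *)
Definition exact_chain (n : nat) (Y X : A) : chain n Y X -> Prop :=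
  match n with
  | 0 => fun g => is_mono g /\ is_epi g
  | n'.+1 => fun c =>
      is_mono (projT2 c).1 /\ exact_after (projT2 c).1 (projT2 c).2
  end.

Fixpoint chain_in (P : set A) (n : nat) (Y X : A) : chain n Y X -> Prop :=
  match n with
  | 0 => fun _ => True
  | n'.+1 => fun c => P (projT1 c) /\ chain_in P (projT2 c).2
  end.

(* Existence of a commutative ladder from c to c' whose leftmost vertical map
   is a and whose rightmost one is the identity of X. *)
Fixpoint chain_map (n : nat) (Y Y' X : A) (a : hom Y Y') {struct n} :
    chain n Y X -> chain n Y' X -> Prop :=
  match n with
  | 0 => fun g g' => g = g' \oc a
  | n'.+1 => fun c c' => exists b : hom (projT1 c) (projT1 c'),
      b \oc (projT2 c).1 = (projT2 c').1 \oc a /\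
      chain_map b (projT2 c).2 (projT2 c').2
  end.

Definition extension (n : nat) (X Y : A) : Type :=
  {c : chain n Y X | exact_chain c}.

Definition extension_map (n : nat) (X Y : A) (c c' : extension n X Y) : Prop :=
  chain_map (idm Y) (sval c) (sval c').

Definition yoneda_equiv (n : nat) (X Y : A) :
    extension n X Y -> extension n X Y -> Prop :=
  clos_refl_sym_trans (extension n X Y) (@extension_map n X Y).

(* Ext^n(X, Y) = 0 for n >= 1: the Yoneda Ext group, whose elements are the
   classes of n-fold extensions, has a single element. *)
Definition Ext_zero (n : nat) (X Y : A) : Prop :=
  forall c c' : extension n X Y, yoneda_equiv c c'.

Definition right_perp (P : set A) : set A :=
  [set M | forall X, P X -> Ext_zero 1 X M].

Definition left_perp (P : set A) : set A :=
  [set M | forall X, P X -> Ext_zero 1 M X].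

Definition cotorsion_pair (P Q : set A) : Prop :=
  right_perp P = Q /\ P = left_perp Q.

Definition Ext_orthogonal (P Q : set A) : Prop :=
  forall X Y (i : nat), P X -> Q Y -> (1 <= i)%N -> Ext_zero i X Y.

Definition hereditary_cotorsion_pair (P Q : set A) : Prop :=
  cotorsion_pair P Q /\ Ext_orthogonal P Q.

Definition complete_cotorsion_pair (P Q : set A) : Prop :=
  cotorsion_pair P Q /\
  forall M : A,
    (exists Y X (f : hom Y X) (g : hom X M),
        [/\ short_exact f g, P X & Q Y]) /\
    (exists Y X (f : hom M Y) (g : hom Y X),
        [/\ short_exact f g, P X & Q Y]).

(* The class of objects M admitting an exact sequence
   0 -> X_n -> ... -> X_0 -> M -> 0 with all X_i in P. *)
Definition hat (P : set A) : set A :=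
  [set M | exists (n : nat) (Xn : A) (c : chain n Xn M),
    [/\ exact_chain c, P Xn & chain_in P c]].

Definition extension_closed (P : set A) : Prop :=
  forall X Y Z (f : hom X Y) (g : hom Y Z),
    short_exact f g -> P X -> P Z -> P Y.

Definition summand_closed (P : set A) : Prop :=
  forall X Y Z (i : hom X Z) (j : hom Y Z) (p : hom Z X) (q : hom Z Y),
    is_biproduct i j p q -> P Z -> P X.

Definition epi_kernel_closed (P : set A) : Prop :=
  forall X Y Z (f : hom X Y) (g : hom Y Z),
    short_exact f g -> P Y -> P Z -> P X.

Definition mono_cokernel_closed (P : set A) : Prop :=
  forall X Y Z (f : hom X Y) (g : hom Y Z),
    short_exact f g -> P X -> P Y -> P Z.

Definition left_thick (P : set A) : Prop :=
  [/\ extension_closed P, summand_closed P & epi_kernel_closed P].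

Definition right_thick (P : set A) : Prop :=
  [/\ extension_closed P, summand_closed P & mono_cokernel_closed P].

Definition thick (P : set A) : Prop := left_thick P /\ right_thick P.

Definition cogenerator (w P : set A) : Prop :=
  w `<=` P /\
  forall X, P X -> exists W X' (f : hom X W) (g : hom W X'),
    [/\ short_exact f g, w W & P X'].

Definition injective_cogenerator (w P : set A) : Prop :=
  cogenerator w P /\ Ext_orthogonal P w.

Record left_weak_AB_context (P Q w : set A) : Prop := LeftWeakABContext {
  AB1 : left_thick P;
  AB2 : right_thick Q /\ Q `<=` hat P;
  AB3 : w = P `&` Q /\ injective_cogenerator w P }.

Definition left_AB_context (P Q w : set A) : Prop :=
  left_weak_AB_context P Q w /\ hat P = setT.

Definition hovey_triple (Q W R : set A) : Prop :=
  [/\ thick W, complete_cotorsion_pair Q (W `&` R)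
    & complete_cotorsion_pair (Q `&` W) R].

Definition hereditary_hovey_triple (Q W R : set A) : Prop :=
  [/\ hovey_triple Q W R, hereditary_cotorsion_pair Q (W `&` R)
    & hereditary_cotorsion_pair (Q `&` W) R].

End Preadditive.

Record abelian_category : Type := AbelianCategory {
  preadditive_of :> preadditive;
  abelianP : is_abelian preadditive_of }.

(* Main.v *)
(* Write w = X /\ Y.  A hereditary complete pair has an epi-kernel closed left
   class, so horseshoes over X-covers show that hat X is thick.  An object of G
   with a finite X-resolution is a summand of an object of X, by pushing the
   resolution out along an embedding into w, so G /\ hat X = X and (X, Y) is
   the second pair.  Objects of hat X /\ Y have finite resolutions by w, and
   the right Ext^1-orthogonal of G is closed under cokernels of monos because G
   is epi-kernel closed and every object is covered by X, hence by G; therefore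
   Ext^1(G, hat X /\ Y) = 0.  Since hat G is everything, the
   Auslander-Buchweitz approximations, built by induction on the length of a
   G-resolution, make (G, hat X /\ Y) a complete cotorsion pair.  Higher Ext
   enters twice only: Ext^2(X, Y) = 0 is what makes X epi-kernel closed, and
   higher orthogonality of the first pair follows from Ext^1 by splicing. *)
Require Import Defs.
From mathcomp Require Import all_boot all_algebra.
From mathcomp Require Import boolp classical_sets.
From Stdlib Require Import Relations.Relation_Operators.

(* all_algebra shadows [hom] and [comp]. *)
Import Defs.

Set Implicit Arguments.
Unset Strict Implicit.
Unset Printing Implicit Defensive.

Import GRing.Theory.
Local Open Scope ring_scope.
Local Open Scope classical_set_scope.

(** * Preadditive and opposite categories *)

Section Preadditive.
Variable A : preadditive.
Implicit Types X Y Z K E : A.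

Lemma comp0m X Y Z (f : hom X Y) : (0 : hom Y Z) \oc f = 0.
Proof. by apply: (addrI ((0 : hom Y Z) \oc f)); rewrite -compDl !addr0. Qed.

Lemma compm0 X Y Z (g : hom Y Z) : g \oc (0 : hom X Y) = 0.
Proof. by apply: (addrI (g \oc (0 : hom X Y))); rewrite -compDr !addr0. Qed.

Lemma compNm X Y Z (g : hom Y Z) (f : hom X Y) : (- g) \oc f = - (g \oc f).
Proof. by apply: (addrI (g \oc f)); rewrite -compDl !subrr comp0m. Qed.

Lemma compmN X Y Z (g : hom Y Z) (f : hom X Y) : g \oc (- f) = - (g \oc f).
Proof. by apply: (addrI (g \oc f)); rewrite -compDr !subrr compm0. Qed.

Lemma compBm X Y Z (g g' : hom Y Z) (f : hom X Y) :
  (g - g') \oc f = g \oc f - g' \oc f.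
Proof. by rewrite compDl compNm. Qed.

Lemma compmB X Y Z (g : hom Y Z) (f f' : hom X Y) :
  g \oc (f - f') = g \oc f - g \oc f'.
Proof. by rewrite compDr compmN. Qed.

Lemma monoP X Y (f : hom X Y) :
  (forall Z (u : hom Z X), f \oc u = 0 -> u = 0) <-> is_mono f.
Proof.
split=> [f0 Z u v fuv|fm Z u fu0]; last by apply: fm; rewrite fu0 compm0.
by apply/subr0_eq/f0; rewrite compmB fuv subrr.
Qed.

Lemma epiP X Y (f : hom X Y) :
  (forall Z (u : hom Y Z), u \oc f = 0 -> u = 0) <-> is_epi f.
Proof.
split=> [f0 Z u v fuv|fm Z u fu0]; last by apply: fm; rewrite fu0 comp0m.
by apply/subr0_eq/f0; rewrite compBm fuv subrr.
Qed.

Lemma epi_comp X Y Z (g : hom Y Z) (f : hom X Y) :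
  is_epi g -> is_epi f -> is_epi (g \oc f).
Proof. by move=> ge fe T u v; rewrite !compA => /fe/ge. Qed.

Lemma mono_comp X Y Z (g : hom Y Z) (f : hom X Y) :
  is_mono g -> is_mono f -> is_mono (g \oc f).
Proof. by move=> gm fm T u v; rewrite -!compA => /gm/fm. Qed.

Lemma epi_of_comp X Y Z (g : hom Y Z) (f : hom X Y) :
  is_epi (g \oc f) -> is_epi g.
Proof. by move=> ge T u v uv; apply: ge; rewrite !compA uv. Qed.

Lemma mono_of_comp X Y Z (g : hom Y Z) (f : hom X Y) :
  is_mono (g \oc f) -> is_mono f.
Proof. by move=> gm T u v uv; apply: gm; rewrite -!compA uv. Qed.

Lemma kernel_mono K X Y (k : hom K X) (f : hom X Y) :
  is_kernel k f -> is_mono k.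
Proof.
move=> [fk0 kP] Z u v kuv.
have [|w [_ wP]] := kP _ (k \oc u); first by rewrite compA fk0 comp0m.
by rewrite -(wP u) // -(wP v).
Qed.

Lemma cokernel_epi X Y K (c : hom Y K) (f : hom X Y) :
  is_cokernel c f -> is_epi c.
Proof.
move=> [cf0 cP] Z u v kuv.
have [|w [_ wP]] := cP _ (u \oc c); first by rewrite -compA cf0 compm0.
by rewrite -(wP u) // -(wP v).
Qed.

Lemma kernel_lift K X Y (k : hom K X) (f : hom X Y) Z (g : hom Z X) :
  is_kernel k f -> f \oc g = 0 -> exists u, k \oc u = g.
Proof. by move=> [_ kP] /kP[u [uE _]]; exists u. Qed.

Lemma cokernel_desc X Y K (c : hom Y K) (f : hom X Y) Z (g : hom Y Z) :
  is_cokernel c f -> g \oc f = 0 -> exists u, u \oc c = g.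
Proof. by move=> [_ kP] /kP[u [uE _]]; exists u. Qed.

Lemma kernel_intro K X Y (k : hom K X) (f : hom X Y) :
    f \oc k = 0 -> is_mono k ->
    (forall Z (g : hom Z X), f \oc g = 0 -> exists u, k \oc u = g) ->
  is_kernel k f.
Proof.
move=> fk0 km kP; split=> // Z g /kP[u uE]; exists u; split=> // v vE.
by apply: km; rewrite uE vE.
Qed.

Lemma kernel_comp_mono K X Y Z (k : hom K X) (f : hom X Y) (m : hom Y Z) :
  is_mono m -> is_kernel k (m \oc f) <-> is_kernel k f.
Proof.
move=> mm; split=> -[fk0 kP]; split.
- by apply: ((monoP m).2 mm); rewrite compA.
- by move=> T g fg0; apply: kP; rewrite -compA fg0 compm0.
- by rewrite -compA fk0 compm0.
- by move=> T g; rewrite -compA => /((monoP m).2 mm); apply: kP.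
Qed.

(** Unlike [short_exact], which goes through an image factorization, this form is visibly
    self-dual. *)
Definition ses X Y Z (f : hom X Y) (g : hom Y Z) : Prop :=
  is_kernel f g /\ is_cokernel g f.

Definition SES X Y Z : Prop := exists (f : hom X Y) (g : hom Y Z), ses f g.

End Preadditive.

Definition op_preadditive (A : preadditive) : preadditive :=
  @Preadditive A (fun X Y => hom Y X) (@idm A)
    (fun X Y Z g f => f \oc g)
    (fun X Y Z T h g f => esym (compA f g h))
    (fun X Y f => compm1 f) (fun X Y f => comp1m f)
    (fun X Y Z g g' f => compDr f g g')
    (fun X Y Z g f f' => compDl f f' g).

Lemma op_abelian (A : preadditive) :
  is_abelian A -> is_abelian (op_preadditive A).
Proof.
case=> z bip ker cok mon epi; split.
- by have [Z [Z1 Z2]] := z; exists Z.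
- move=> X Y; have [Z [i [j [p [q [pi qj pj qi ipjq]]]]]] := bip X Y.
  by exists Z, p, q, i, j.
- by move=> X Y f; apply: cok.
- by move=> X Y f; apply: ker.
- by move=> X Y f; apply: epi.
- by move=> X Y f; apply: mon.
Qed.

(* A dual is often the lemma itself at [op A], up to conversion; the sections
   are closed where this needs the lemma for all categories. *)
Definition op (A : abelian_category) : abelian_category :=
  AbelianCategory (op_abelian (abelianP A)).

Lemma op_ses (A : preadditive) (X Y Z : A) (f : hom X Y) (g : hom Y Z) :
  ses f g -> @ses (op_preadditive A) Z Y X g f.
Proof. by case. Qed.

(** * Short exact sequences *)

Section Normality.
Variable A : abelian_category.
Implicit Types X Y Z K E M N : A.

(** By normality [f] is the cokernel of some [g], and [g] factors through [k], so whatever kills [k]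
    kills [g]. *)
Lemma epi_cokernel K X Y (k : hom K X) (f : hom X Y) :
  is_epi f -> is_kernel k f -> is_cokernel f k.
Proof.
move=> fe kP; have [Z [g [fg0 gP]]] := epi_normal (abelianP A) fe.
split=> [|T h hk0]; first by case: kP.
by apply: gP; have [u <-] := kernel_lift kP fg0; rewrite compA hk0 comp0m.
Qed.

End Normality.

Section Exactness.
Variable A : abelian_category.
Implicit Types X Y Z K E M N : A.

Lemma mono_kernel X Y C (f : hom X Y) (c : hom Y C) :
  is_mono f -> is_cokernel c f -> is_kernel f c.
Proof. exact: (@epi_cokernel (op A) C Y X c f). Qed.

Lemma ses_of_epi X Y (f : hom X Y) :
  is_epi f -> exists K (k : hom K X), ses k f.
Proof.
move=> fe; have [K [k kP]] := has_kernels (abelianP A) f.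
by exists K, k; split=> //; apply: epi_cokernel.
Qed.

Lemma ses_of_mono X Y (f : hom X Y) :
  is_mono f -> exists C (c : hom Y C), ses f c.
Proof.
move=> fm; have [K [k kP]] := has_cokernels (abelianP A) f.
by exists K, k; split=> //; apply: mono_kernel.
Qed.

Lemma mono_epi_iso X Y (f : hom X Y) : is_mono f -> is_epi f -> is_iso f.
Proof.
move=> fm fe; have [C [c [fK fC]]] := ses_of_mono fm.
have c0 : c = 0 by apply/(proj2 (epiP f)) => //; case: fC.
have [|g gE] := kernel_lift (g := idm Y) fK; first by rewrite c0 comp0m.
exists g; split=> //; apply: fm.
by rewrite compA gE comp1m compm1.
Qed.

Lemma iso_mono X Y (f : hom X Y) : is_iso f -> is_mono f.
Proof.
by case=> g [gf _] Z u v fuv; rewrite -[u]comp1m -[v]comp1m -gf -!compA fuv.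
Qed.

Lemma iso_epi X Y (f : hom X Y) : is_iso f -> is_epi f.
Proof.
by case=> g [_ fg] Z u v fuv; rewrite -[u]compm1 -[v]compm1 -fg !compA fuv.
Qed.

Lemma idm_iso X : is_iso (idm X).
Proof. by exists (idm X); rewrite comp1m. Qed.

Lemma kernel_exact X Y Z (f : hom X Y) (g : hom Y Z) :
  is_kernel f g -> exact f g.
Proof.
move=> fg; exists X, (idm X), f; rewrite compm1.
split=> //; exact/iso_epi/idm_iso.
Qed.

Lemma exact_comp0 X Y Z (f : hom X Y) (g : hom Y Z) :
  exact f g -> g \oc f = 0.
Proof. by case=> I [e [m [_ [gm _] ->]]]; rewrite compA gm comp0m. Qed.

Lemma mono_exact_kernel X Y Z (f : hom X Y) (g : hom Y Z) :
  is_mono f -> exact f g -> is_kernel f g.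
Proof.
move=> fm fg; have gf := exact_comp0 fg; case: fg => I [e [m [ee mK fE]]].
have em : is_mono e by apply: (@mono_of_comp _ _ _ _ m); rewrite -fE.
have [e' [_ ee']] := mono_epi_iso em ee.
apply: kernel_intro => // T u gu; have [v <-] := kernel_lift mK gu.
by exists (e' \oc v); rewrite fE compA -(compA m) ee' compm1.
Qed.

Lemma short_exactP X Y Z (f : hom X Y) (g : hom Y Z) :
  short_exact f g <-> ses f g.
Proof.
split=> [[fm fg ge]|[fK gC]].
  by have fK := mono_exact_kernel fm fg; split=> //; apply: epi_cokernel.
split; [exact: kernel_mono fK|exact: kernel_exact|exact: cokernel_epi gC].
Qed.

Lemma ses_epi X Y Z (f : hom X Y) (g : hom Y Z) : ses f g -> is_epi g.
Proof. by case=> _; apply: cokernel_epi. Qed.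

Lemma ses_mono X Y Z (f : hom X Y) (g : hom Y Z) : ses f g -> is_mono f.
Proof. by case=> + _; apply: kernel_mono. Qed.

Lemma ses0 X Y Z (f : hom X Y) (g : hom Y Z) : ses f g -> g \oc f = 0.
Proof. by case=> -[]. Qed.

Lemma ses_intro_epi X Y Z (f : hom X Y) (g : hom Y Z) :
  is_kernel f g -> is_epi g -> ses f g.
Proof. by move=> fK ge; split=> //; apply: epi_cokernel. Qed.

(** * Pullbacks and pushouts of short exact sequences *)

Definition is_pullback P X Y Z (a : hom P X) (b : hom P Y)
    (f : hom X Z) (g : hom Y Z) : Prop :=
  f \oc a = g \oc b /\
  forall T (u : hom T X) (v : hom T Y), f \oc u = g \oc v ->
    exists! w : hom T P, a \oc w = u /\ b \oc w = v.

(** The pullback is the kernel of [f \oc p - g \oc q] on the biproduct of [X] and [Y]. *)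
Lemma pullback_epi_exists X Y Z (f : hom X Z) (g : hom Y Z) : is_epi f ->
  exists P (a : hom P X) (b : hom P Y), is_pullback a b f g /\ is_epi b.
Proof.
move=> fe; have [S [i [j [p [q [pi qj pj qi ipjq]]]]]] :=
  has_biproducts (abelianP A) X Y.
pose d := f \oc p - g \oc q.
have di : d \oc i = f by rewrite compBm -!compA pi qi compm0 compm1 subr0.
have de : is_epi d by apply: (@epi_of_comp _ _ _ _ _ i); rewrite di.
have [P [m mS]] := ses_of_epi de.
exists P, (p \oc m), (q \oc m); split.
  split; first by apply/subr0_eq; rewrite !compA -compBm (ses0 mS).
  move=> T u v fugv.
  have [|w wE] := kernel_lift (g := i \oc u + j \oc v) (proj1 mS).
    rewrite compDr 2!compA di compBm -!compA pj qj compm0 sub0r compm1.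
    by rewrite compNm fugv subrr.
  exists w; split=> [|w' [w1 w2]].
    rewrite -!compA wE !compDr !compA pi pj qi qj.
    by rewrite !comp0m !comp1m addr0 add0r.
  apply: (ses_mono mS); rewrite wE -w1 -w2 -[RHS]comp1m -ipjq compDl.
  by rewrite !compA.
(* If [u] kills the projection, [u \oc q] factors as [v \oc d]; restricting along [i] gives
   [v \oc f = 0], hence [v = 0] and [u = 0]. *)
apply/epiP => T u; rewrite compA => uqm.
have [v vE] := cokernel_desc (proj2 mS) uqm.
have v0 : v = 0.
  apply: (proj2 (epiP f) fe); rewrite -di compA vE -compA qi compm0 //.
by rewrite -[u]compm1 -qj compA -vE v0 comp0m comp0m.
Qed.

Lemma pullback_kernel P X Y Z (a : hom P X) (b : hom P Y)
    (f : hom X Z) (g : hom Y Z) K (k : hom K X) :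
    is_pullback a b f g -> is_kernel k f ->
  exists k' : hom K P, a \oc k' = k /\ is_kernel k' b.
Proof.
move=> [fagb PP] kK; have km := kernel_mono kK.
have [|k' [[ak bk] _]] := PP _ k 0; first by rewrite compm0; case: kK.
exists k'; split=> //; apply: kernel_intro => // [|T u bu].
  by apply: (@mono_of_comp _ _ _ _ a); rewrite ak.
have [|v kv] := kernel_lift (g := a \oc u) kK.
  by rewrite compA fagb -compA bu compm0.
exists v.
have [|w [_ wP]] := PP _ (a \oc u) (b \oc u); first by rewrite !compA fagb.
by rewrite -(wP u) // -(wP (k' \oc v)) // !compA ak bk comp0m kv bu.
Qed.

Lemma pullback_sym P X Y Z (a : hom P X) (b : hom P Y)
    (f : hom X Z) (g : hom Y Z) : is_pullback a b f g -> is_pullback b a g f.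
Proof.
move=> [fagb PP]; split=> // T u v uv.
have [w [[w1 w2] wP]] := PP _ _ _ (esym uv).
by exists w; split=> // w' [? ?]; apply: wP.
Qed.

Lemma pullback_ses K X Z Y (k : hom K X) (f : hom X Z) (g : hom Y Z) :
    ses k f ->
  exists P (a : hom P X) (b : hom P Y) (k' : hom K P),
    [/\ is_pullback a b f g, ses k' b & a \oc k' = k].
Proof.
move=> kf; have [P [a [b [PB be]]]] := pullback_epi_exists g (ses_epi kf).
have [k' [ak kK]] := pullback_kernel PB (proj1 kf).
by exists P, a, b, k'; split=> //; apply: ses_intro_epi.
Qed.

(** The kernel of [g \oc f] is the pullback of [k'] along [f], hence an extension of [K'] by [K]. *)
Lemma ses_comp_epi K X Y K' Z (k : hom K X) (f : hom X Y) (k' : hom K' Y)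
    (g : hom Y Z) : ses k f -> ses k' g ->
  exists P (a : hom P X) (b : hom P K') (k'' : hom K P),
    [/\ ses a (g \oc f), ses k'' b, a \oc k'' = k & f \oc a = k' \oc b].
Proof.
move=> kf kg; have [P [a [b [k'' [PB kb ak]]]]] := pullback_ses k' kf.
exists P, a, b, k''; split=> //; last by case: PB.
apply: ses_intro_epi; last exact: epi_comp (ses_epi kg) (ses_epi kf).
have [fa PP] := PB.
apply: kernel_intro => [||T u].
- by rewrite -compA fa compA (ses0 kg) comp0m.
- apply/monoP => T u au.
  have bu : b \oc u = 0.
    apply: (ses_mono kg); rewrite compm0 compA -fa -compA au compm0 //.
  have [|w [_ wP]] := PP _ (a \oc u) (b \oc u); first by rewrite !compA fa.
  by rewrite -(wP u) // -(wP 0) // !compm0 au bu.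
- rewrite -compA => gfu; have [v vE] := kernel_lift (proj1 kg) gfu.
  by have [w [[w1 _] _]] := PP _ _ _ (esym vE); exists w.
Qed.

End Exactness.

Section Pushouts.
Variable A : abelian_category.
Implicit Types X Y Z K E M N : A.

Lemma pushout_ses K X Z Y (k : hom X K) (f : hom Z X) (g : hom Z Y) :
    ses f k ->
  exists P (a : hom X P) (b : hom Y P) (k' : hom P K),
    [/\ @is_pullback (op A) P X Y Z a b f g, ses b k' & k' \oc a = k].
Proof.
move=> fk; have [P [a [b [k' [PB [S1 S2] E]]]]] :=
  @pullback_ses (op A) K X Z Y k f g (op_ses fk).
by exists P, a, b, k'.
Qed.

End Pushouts.

Section Extensions.
Variable A : abelian_category.
Implicit Types X Y Z K E C M N : A.

(** The pullback built in [pullback_epi_exists] maps to the given one, so its epi projection factors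
    through [b]. *)
Lemma pullback_epi P X Y Z (a : hom P X) (b : hom P Y)
    (f : hom X Z) (g : hom Y Z) : is_pullback a b f g -> is_epi f -> is_epi b.
Proof.
move=> [fagb PP] /(pullback_epi_exists g)[P' [a' [b' [[E _] b'e]]]].
have [w [[_ wb] _]] := PP _ _ _ E.
by apply: (@epi_of_comp _ _ _ _ _ w); rewrite wb.
Qed.

Lemma SES_pullback K E K' E' X : SES K E X -> SES K' E' X ->
  exists P, SES K P E' /\ SES K' P E.
Proof.
move=> [k [f kf]] [k' [f' kf']].
have [P [a [b [u [PB ub _]]]]] := pullback_ses f' kf.
exists P; split; first by exists u, b.
have [v [_ vK]] := pullback_kernel (pullback_sym PB) (proj1 kf').
by exists v, a; apply: ses_intro_epi => //;
  apply: pullback_epi (pullback_sym PB) (ses_epi kf').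
Qed.

Lemma SES_comp_epi K X Y K' Z : SES K X Y -> SES K' Y Z ->
  exists P, SES P X Z /\ SES K P K'.
Proof.
move=> [k [f kf]] [k' [f' kf']].
have [P [a [b [c [S1 S2 _ _]]]]] := ses_comp_epi kf kf'.
by exists P; split; [exists a, (f' \oc f)|exists c, b].
Qed.

Lemma op_SES X Y Z : SES X Y Z -> @SES (op A) Z Y X.
Proof. by move=> [f [g [? ?]]]; exists g, f. Qed.

Lemma ses_section X Y Z (f : hom X Y) (g : hom Y Z) (r : hom Y X) :
  ses f g -> r \oc f = idm X ->
  exists s, [/\ g \oc s = idm Z, r \oc s = 0 & f \oc r + s \oc g = idm Y].
Proof.
move=> fg rf.
have [|s sg] := cokernel_desc (g := idm Y - f \oc r) (proj2 fg).
  by rewrite compBm comp1m -compA rf compm1 subrr.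
exists s; split; last by rewrite sg addrC subrK.
- apply: (ses_epi fg); rewrite -compA sg compmB compm1 compA (ses0 fg) comp0m.
  by rewrite subr0 comp1m.
- apply: (ses_epi fg).
  by rewrite -compA sg compmB compm1 compA rf !comp1m subrr comp0m.
Qed.

(** The vanishing of [Ext^1(C, Y)] as an extension property along monos with cokernel [C]; [Ext1P]
    compares it with Yoneda classes. *)
Definition orth C Y : Prop := forall M N (f : hom M N) (g : hom N C),
  ses f g -> forall u : hom M Y, exists v : hom N Y, v \oc f = u.

(** Push the extension out along [u]; a retraction of the pushout onto [Y] yields the extension of
    [u]. *)
Lemma orth_retraction C Y :
    (forall E (f : hom Y E) (g : hom E C), ses f g ->
       exists r, r \oc f = idm Y) -> orth C Y.
Proof.
move=> H M N f g fg u.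
have [P [a [b [k' [[E _] bk _]]]]] := pushout_ses u fg.
have [r rb] := H _ _ _ bk; exists (r \oc a).
by move: E; rewrite /= -compA => ->; rewrite compA rb comp1m.
Qed.

End Extensions.

Section OrthogonalityOp.
Variable A : abelian_category.

(** The dual property lifts maps out of [C] along epis with kernel [Y]. Pulling such an epi back
    gives an extension of [C] by [Y], and a section of it gives the lift. *)
Lemma orth_op (C Y : A) : orth C Y -> @orth (op A) Y C.
Proof.
move=> CY N M f g [fg1 fg2] u.
have fg : @ses A Y M N g f by split.
have [P [a [b [k' [PB kb _]]]]] := @pullback_ses A _ _ _ _ g f u fg.
have [r rk] := CY _ _ _ _ kb (idm _).
have [s [bs _ _]] := ses_section kb rk.
exists (a \oc s).
by case: PB => /= E _; rewrite compA E -compA bs compm1.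
Qed.

End OrthogonalityOp.

Section Orthogonality.
Variable A : abelian_category.
Implicit Types X Y Z K E C M N : A.

Lemma SES_pushout K E K' E' X : SES X E K -> SES X E' K' ->
  exists P, SES E' P K /\ SES E P K'.
Proof.
move=> /op_SES S1 /op_SES S2.
by have [P [/op_SES T1 /op_SES T2]] := SES_pullback S1 S2; exists P.
Qed.

Lemma SES_comp_mono K X Y K' Z : SES Y X K -> SES Z Y K' ->
  exists P, SES Z X P /\ SES K' P K.
Proof.
move=> /op_SES S1 /op_SES S2.
by have [P [/op_SES T1 /op_SES T2]] := SES_comp_epi S1 S2; exists P.
Qed.

Lemma orth_lift C Y : orth C Y -> forall M N (f : hom Y M) (g : hom M N),
  ses f g -> forall u : hom C N, exists v : hom C M, g \oc v = u.
Proof. by move=> /orth_op CY M N f g fg; apply: CY; apply: op_ses fg. Qed.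

Lemma op_orth C Y : @orth (op A) Y C -> orth C Y.
Proof. exact: (@orth_op (op A)). Qed.

Lemma lift_orth C Y : (forall M N (f : hom Y M) (g : hom M N),
  ses f g -> forall u : hom C N, exists v : hom C M, g \oc v = u) -> orth C Y.
Proof. by move=> H; apply: op_orth => N M g f [? ?]; apply: (H M N f g). Qed.

(** A map on [M] extends in two stages: to the kernel of [N ->> Z] because of [X], then to [N]
    because of [Z]. *)
Lemma orth_extension X Y Z W : SES X Y Z -> orth X W -> orth Z W -> orth Y W.
Proof.
move=> [k' [g kg]] XW ZW M N f h fh u.
have [P [a [b [k [S1 S2 ak _]]]]] := ses_comp_epi fh kg.
have [v vk] := XW _ _ _ _ S2 u; have [w wa] := ZW _ _ _ _ S1 v.
by exists w; rewrite -ak compA wa.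
Qed.

Lemma orth_retract X Z W (i : hom X Z) (p : hom Z X) :
  p \oc i = idm X -> orth Z W -> orth X W.
Proof.
move=> pi ZW; apply: lift_orth => M N f g fg u.
have [v vE] := orth_lift ZW fg (u \oc p).
by exists (v \oc i); rewrite compA vE -compA pi compm1.
Qed.

End Orthogonality.

Section OrthogonalityRight.
Variable A : abelian_category.
Implicit Types X Y Z K E C M N W : A.

Lemma orth_extension_r X Y Z W : SES X Y Z -> orth W X -> orth W Z -> orth W Y.
Proof.
by move=> /op_SES S /orth_op WX /orth_op WZ; apply/op_orth/(orth_extension S).
Qed.

End OrthogonalityRight.

(** * First and second Ext groups *)

Section Ext1.
Variable A : abelian_category.
Implicit Types X Y Z K E C M N W : A.

Lemma yoneda_invariant n X Y (P : extension n X Y -> Prop) :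
    (forall c c', extension_map c c' -> P c <-> P c') ->
  forall c c', yoneda_equiv c c' -> P c <-> P c'.
Proof.
move=> H c c'.
elim=> {c c'} [c c' /H //|//|c c' _ [? ?]|c c' c'' _ [? ?] _ [? ?]]; by split; auto.
Qed.

Lemma biproduct_ses X Y Z (i : hom X Z) (j : hom Y Z) (p : hom Z X)
  (q : hom Z Y) : is_biproduct i j p q -> ses i q.
Proof.
move=> [pi qj pj qi ipjq]; apply: ses_intro_epi.
  apply: kernel_intro => // [T u v E|T u qu].
    by rewrite -[u]comp1m -[v]comp1m -pi -!compA E.
  exists (p \oc u); rewrite -[RHS]comp1m -ipjq compDl -!compA qu.
  by rewrite compm0 addr0.
by move=> T u v E; rewrite -[u]compm1 -[v]compm1 -qj !compA E.
Qed.

Lemma exact_chain1 C Y E (f : hom Y E) (g : hom E C) :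
  @exact_chain _ 1 Y C (existT _ E (f, g)) <-> ses f g.
Proof.
split=> [[fm [fg ge]]|/short_exactP[fm fg ge]]; last by [].
exact/short_exactP.
Qed.

(** Being split is invariant under maps of 1-extensions and holds for the biproduct. Conversely,
    orthogonality gives a retraction of one extension and a section of the other, hence a map
    between them. *)
Lemma Ext1P C Y : Ext_zero 1 C Y <-> orth C Y.
Proof.
split=> [Ext0|CY].
  pose retr (c : extension 1 C Y) :=
    exists r, r \oc (projT2 (sval c)).1 = idm Y.
  have inv c c' : extension_map c c' -> retr c <-> retr c'.
    case: c c' => [[E [f g]] cP] [[E' [f' g']] cP'] [/= b [bf gb]].
    have /= fg := (exact_chain1 _ _).1 cP.
    have /= fg' := (exact_chain1 _ _).1 cP'.
    rewrite compm1 in bf.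
    split=> -[/= r rf]; last by exists (r \oc b); rewrite /= -compA bf.
    have [s [gs _ _]] := ses_section fg rf.
    (* The section of [g] is carried by [b] to a section of [g'], which the dual of [ses_section]
       turns into a retraction of [f']. *)
    pose r' := @ses_section (op A) _ _ _ g' f' (b \oc s) (op_ses fg').
    have [|r'' [? _ _]] := r'; first by rewrite /= compA -gb.
    by exists r''.
  have [Z [i [j [p [q ijpq]]]]] := has_biproducts (abelianP A) Y C.
  apply: orth_retraction => E f g /exact_chain1 fg.
  have /exact_chain1 iq := biproduct_ses ijpq.
  apply: (proj2 (yoneda_invariant inv (Ext0 (exist _ _ fg) (exist _ _ iq)))).
  by exists p; case: ijpq.
move=> [[E [f g]] cP] [[E' [f' g']] cP'].
have /= fg := (exact_chain1 _ _).1 cP.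
have /= fg' := (exact_chain1 _ _).1 cP'.
have [r rf] := CY _ _ _ _ fg (idm Y).
have [s gs] := orth_lift CY fg' (idm C).
apply: rst_step; exists (f' \oc r + s \oc g); split=> /=.
  by rewrite compDl -!compA rf (ses0 fg) compm0 addr0.
by rewrite compDr !compA gs (ses0 fg') comp0m comp1m add0r.
Qed.

End Ext1.

Section Ext2Filling.
Variable A : abelian_category.
Implicit Types X Y Z K E C M N W F : A.

(** Fillings travel backwards along a map of 2-extensions: [F] is the pullback of [F'] along
    [b1]. *)
Lemma fill_pullback Y E2 E1 X E2' E1' F' (f : hom Y E2) (h : hom E2 E1)
    (f' : hom Y E2') (h' : hom E2' E1') (b2 : hom E2 E2') (b1 : hom E1 E1')
    (s' : hom E2' F') (t' : hom F' E1') :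
    b2 \oc f = f' -> b1 \oc h = h' \oc b2 -> h \oc f = 0 ->
    t' \oc s' = h' -> ses (s' \oc f') t' ->
  exists F (s : hom E2 F) (t : hom F E1), t \oc s = h /\ ses (s \oc f) t.
Proof.
move=> bf bh hf ts' sf'.
have [F [a [t [k [[E PP] kt ak]]]]] := pullback_ses b1 sf'.
have [|s [[as_ ts] _]] := PP _ (s' \oc b2) h; first by rewrite compA ts' bh.
exists F, s, t; split=> //.
have [|w [_ wP]] := PP _ (s' \oc f') 0.
  by rewrite (ses0 sf') compm0.
have <- : k = s \oc f; last by [].
rewrite -(wP k) ?(wP (s \oc f)) ?ak ?(ses0 kt) //.
by rewrite !compA as_ ts hf -compA bf.
Qed.

(** The same [F] is an extension of [X] by [E2], which is the filling condition in the opposite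
    category. *)
Lemma fill_dual Y E2 K E1 X F (f : hom Y E2) (e : hom E2 K) (m : hom K E1)
    (g : hom E1 X) (s : hom E2 F) (t : hom F E1) :
    ses f e -> ses m g -> t \oc s = m \oc e -> ses (s \oc f) t ->
  ses s (g \oc t).
Proof.
move=> fe mg ts sft.
have sm : is_mono s.
  apply/monoP => T u su.
  have [|v vE] := kernel_lift (g := u) (proj1 fe).
    by apply: (ses_mono mg); rewrite compA -ts -compA su !compm0.
  rewrite -vE; suff -> : v = 0 by rewrite compm0.
  by apply: (ses_mono sft); rewrite -compA vE su compm0.
have [C [q sq]] := ses_of_mono sm.
apply: ses_intro_epi; last exact: epi_comp (ses_epi mg) (ses_epi sft).
apply: kernel_intro => // [|T w].
  by rewrite -compA ts compA (ses0 mg) comp0m.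
rewrite -compA => gtw; have [z zE] := kernel_lift (proj1 mg) gtw.
(* [z] lifts to [E2] only after the epi [b]; there [w] differs from [s \oc a] by a map through
   [s \oc f], so [q \oc w] vanishes. *)
have [P [a [b [[E _] be]]]] := pullback_epi_exists z (ses_epi fe).
have [|y yE] := kernel_lift (g := w \oc b - s \oc a) (proj1 sft).
  by rewrite compmB !compA -zE ts -!compA E subrr.
apply: (kernel_lift (proj1 sq)).
apply: ((epiP b).2 be); rewrite -compA -[w \oc b](subrK (s \oc a)) -yE.
by rewrite compDr !compA (ses0 sq) !comp0m addr0.
Qed.

End Ext2Filling.

Section Ext2Zero.
Variable A : abelian_category.
Implicit Types X Y Z K E C M N W F : A.

Lemma exact_chain2 Y E2 E1 X (f : hom Y E2) (h : hom E2 E1) (g : hom E1 X) :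
    @exact_chain _ 2 Y X (existT _ E2 (f, existT _ E1 (h, g))) <->
  exists K (e : hom E2 K) (m : hom K E1), [/\ ses f e, ses m g & h = m \oc e].
Proof.
split=> [[/= fm [fh [hg ge]]]|[K [e [m [fe mg ->]]]]].
  have fK := mono_exact_kernel fm fh.
  case: hg => K [e [m [ee mK hE]]]; exists K, e, m; split=> //.
    apply: ses_intro_epi => //; apply/(kernel_comp_mono _ _ (kernel_mono mK)).
    by rewrite -hE.
  exact: ses_intro_epi.
split=> /=; first exact: ses_mono fe.
split; first by apply/kernel_exact/kernel_comp_mono;
  [exact: ses_mono mg|case: fe].
split; last exact: ses_epi mg.
by exists K, e, m; split=> //; [exact: ses_epi fe|case: mg].
Qed.

(* A 2-extension that is the splice of an extension [Y >-> E2 ->> K] with an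
   extension [K >-> E1 ->> X] is zero exactly when the former is the
   restriction to [K] of an extension [Y >-> F ->> E1].  By [fill_dual] this
   condition is self-dual, hence invariant under maps of 2-extensions in both
   directions. *)
Lemma Ext2_fill X Y K E1 E2 (f : hom Y E2) (e : hom E2 K) (m : hom K E1)
    (g : hom E1 X) : Ext_zero 2 X Y -> ses f e -> ses m g ->
  exists F (s : hom E2 F) (t : hom F E1), t \oc s = m \oc e /\ ses (s \oc f) t.
Proof.
move=> Ext0 fe mg.
pose fill (c : extension 2 X Y) :=
  exists F (s : hom (projT1 (sval c)) F)
      (t : hom F (projT1 (projT2 (sval c)).2)),
    t \oc s = (projT2 (projT2 (sval c)).2).1 /\
    ses (s \oc (projT2 (sval c)).1) t.
have inv c c' : extension_map c c' -> fill c <-> fill c'.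
  case: c c' => [[Z2 [f1 [Z1 [h1 g1]]]] cP] [[Z2' [f1' [Z1' [h1' g1']]]] cP'].
  move=> [/= b2 [b2f [b1 [/= b1h g1b]]]]; rewrite compm1 in b2f.
  have [K1 [e1 [m1 [fe1 mg1 hE]]]] := (exact_chain2 _ _ _).1 cP.
  have [K1' [e1' [m1' [fe1' mg1' hE']]]] := (exact_chain2 _ _ _).1 cP'.
  split=> -[F [s [t [/= ts sft]]]].
    (* Fillings move forward by dualizing, pulling back in the opposite category, and dualizing
       again. *)
    have sgt : ses s (g1 \oc t).
      by apply: (fill_dual fe1 mg1 _ sft); rewrite -hE.
    have gh : g1' \oc h1' = 0 by rewrite hE' compA (ses0 mg1') comp0m.
    have [F' [t' [s' [ts' sgt']]]] := @fill_pullback (op A)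
      X Z1' Z2' Y Z1 Z2 F g1' h1' g1 h1 b1 b2 t s
      (esym g1b) (esym b1h) gh ts (op_ses sgt).
    exists F', s', t'; split=> //.
    by have [] := @fill_dual (op A) _ _ _ _ _ _ _ _ _ _ _ _
      (op_ses mg1') (op_ses fe1') (etrans ts' hE') sgt'.
  have hf : h1 \oc f1 = 0 by rewrite hE -compA (ses0 fe1) compm0.
  exact: (@fill_pullback A Y Z2 Z1 X Z2' Z1' F f1 h1 f1' h1' b2 b1 s t).
(* The reference 2-extension is [Y = Y -> X = X] with zero middle map; the biproduct of [Y] and [X]
   fills it. *)
have [O [O1 O2]] := has_zero (abelianP A).
have [F [i [j [p [q ijpq]]]]] := has_biproducts (abelianP A) Y X.
have idses (Z : A) : ses (idm Z) (0 : hom Z O) /\ ses (0 : hom O Z) (idm Z).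
  split; (apply: ses_intro_epi; [apply: kernel_intro|]).
  - by rewrite comp0m.
  - exact/iso_mono/idm_iso.
  - by move=> T u _; exists u; rewrite comp1m.
  - by move=> T u v _; rewrite (O2 _ u) (O2 _ v).
  - by rewrite compm0.
  - by move=> T u v _; rewrite (O1 _ u) (O1 _ v).
  - by move=> T u; rewrite comp1m => ->; exists 0; rewrite comp0m.
  - exact/iso_epi/idm_iso.
have cP : @exact_chain _ 2 Y X (existT _ E2 (f, existT _ E1 (m \oc e, g))).
  by apply/exact_chain2; exists K, e, m.
have c0P : @exact_chain _ 2 Y X (existT _ Y (idm Y, existT _ X (0, idm X))).
  apply/exact_chain2; exists O, 0, 0; rewrite comp0m.
  by have [? _] := idses Y; have [_ ?] := idses X.
apply: (proj2 (yoneda_invariant inv (Ext0 (exist _ _ cP) (exist _ _ c0P)))).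
exists F, i, q; rewrite /= compm1; split; last exact: biproduct_ses ijpq.
by case: ijpq.
Qed.

(** An extension of [K] by [Y] is, by filling, the restriction of an extension of [X] by [Y]; a
    retraction of the latter restricts to one of the former. *)
Lemma epi_kernel_orth K X X' Y : SES K X X' -> orth X Y -> Ext_zero 2 X' Y ->
  orth K Y.
Proof.
move=> [m [g mg]] XY Ext0; apply: orth_retraction => E f e fe.
have [F [s [t [_ sft]]]] := Ext2_fill Ext0 fe mg.
have [r rE] := XY _ _ _ _ sft (idm Y).
by exists (r \oc s); rewrite -compA.
Qed.

End Ext2Zero.

(** * Finite resolutions *)

Section Resolutions.
Variable A : abelian_category.
Implicit Types X Y Z K E C M N W F : A.
Implicit Type P : set A.

(** Iterated syzygies instead of chains, so that induction on the length starts from [M]; [hatP]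
    relates the two. *)
Fixpoint res P (n : nat) M : Prop :=
  match n with
  | 0 => P M
  | n'.+1 => exists K X, [/\ SES K X M, P X & res P n' K]
  end.

Definition covers P := forall M, exists K X, SES K X M /\ P X.

Lemma zero_SES : exists O, forall M, SES O M M /\ SES M M O.
Proof.
have [O [O1 O2]] := has_zero (abelianP A).
exists O => M; split; [exists 0, (idm M)|exists (idm M), 0];
  (apply: ses_intro_epi; [apply: kernel_intro|]).
- by rewrite compm0.
- by move=> T u v _; rewrite (O1 _ u) (O1 _ v).
- by move=> T u; rewrite comp1m => ->; exists 0; rewrite comp0m.
- exact/iso_epi/idm_iso.
- by rewrite comp0m.
- exact/iso_mono/idm_iso.
- by move=> T u _; exists u; rewrite comp1m.
- by move=> T u v _; rewrite (O2 _ u) (O2 _ v).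
Qed.

Lemma biproduct_SES X Y Z (i : hom X Z) (j : hom Y Z) (p : hom Z X)
  (q : hom Z Y) : is_biproduct i j p q -> SES X Z Y.
Proof. by move=> /biproduct_ses S; exists i, q. Qed.

Lemma sum_SES K V X K' V' Y KK VV Z
    (iK : hom K KK) (jK : hom K' KK) (pK : hom KK K) (qK : hom KK K')
    (iV : hom V VV) (jV : hom V' VV) (pV : hom VV V) (qV : hom VV V')
    (i : hom X Z) (j : hom Y Z) (p : hom Z X) (q : hom Z Y) :
    is_biproduct iK jK pK qK -> is_biproduct iV jV pV qV ->
    is_biproduct i j p q ->
  SES K V X -> SES K' V' Y -> SES KK VV Z.
Proof.
move=> [pi1 qj1 pj1 qi1 id1] [pi2 qj2 pj2 qi2 id2] [pi3 qj3 pj3 qi3 id3].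
move=> [k [g kg]] [k' [g' kg']].
pose kk := iV \oc k \oc pK + jV \oc k' \oc qK.
pose gg := i \oc g \oc pV + j \oc g' \oc qV.
have pkk : pV \oc kk = k \oc pK.
  by rewrite compDr !compA pi2 pj2 !comp0m comp1m addr0.
have qkk : qV \oc kk = k' \oc qK.
  by rewrite compDr !compA qi2 qj2 !comp0m comp1m add0r.
clearbody kk.
have pgg : p \oc gg = g \oc pV.
  by rewrite compDr !compA pi3 pj3 !comp0m comp1m addr0.
have qgg : q \oc gg = g' \oc qV.
  by rewrite compDr !compA qi3 qj3 !comp0m comp1m add0r.
exists kk, gg; apply: ses_intro_epi.
  apply: kernel_intro => [||T u ggu].
  - by rewrite compDl -!compA pkk qkk !(compA _ _ pK, compA _ _ qK)
      (ses0 kg) (ses0 kg') !compm0 !comp0m addr0.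
  - apply/monoP => T u kku; rewrite -[u]comp1m -id1 compDl -!compA.
    have -> : pK \oc u = 0.
      by apply: (ses_mono kg); rewrite compA -pkk -compA kku !compm0.
    have -> : qK \oc u = 0.
      by apply: (ses_mono kg'); rewrite compA -qkk -compA kku !compm0.
    by rewrite !compm0 addr0.
  - have [|v vE] := kernel_lift (g := pV \oc u) (proj1 kg).
      by rewrite compA -pgg -compA ggu compm0.
    have [|w wE] := kernel_lift (g := qV \oc u) (proj1 kg').
      by rewrite compA -qgg -compA ggu compm0.
    pose x := iK \oc v + jK \oc w; exists x.
    have px : pK \oc x = v.
      by rewrite compDr !compA pi1 pj1 comp0m comp1m addr0.
    have qx : qK \oc x = w.
      by rewrite compDr !compA qi1 qj1 comp0m comp1m add0r.
    rewrite -[LHS]comp1m -[RHS]comp1m -id2 !compDl -!compA.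
    by rewrite (compA pV) pkk (compA qV) qkk -!compA px qx vE wE.
apply/epiP => T u ugg; rewrite -[u]compm1 -id3 compDr !compA.
have ggi : gg \oc iV = i \oc g.
  by rewrite compDl -!compA pi2 qi2 !compm0 compm1 addr0.
have ggj : gg \oc jV = j \oc g'.
  by rewrite compDl -!compA pj2 qj2 !compm0 compm1 add0r.
have -> : u \oc i = 0.
  by apply: (ses_epi kg); rewrite -compA -ggi compA ugg !comp0m.
have -> : u \oc j = 0.
  by apply: (ses_epi kg'); rewrite -compA -ggj compA ugg !comp0m.
by rewrite !comp0m addr0.
Qed.

Lemma extension_closed_SES P : extension_closed P ->
  forall X Y Z, SES X Y Z -> P X -> P Z -> P Y.
Proof. by move=> H X Y Z [f [g /short_exactP/H]]. Qed.

Lemma epi_kernel_closed_SES P : epi_kernel_closed P ->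
  forall X Y Z, SES X Y Z -> P Y -> P Z -> P X.
Proof. by move=> H X Y Z [f [g /short_exactP/H]]. Qed.

Lemma mono_cokernel_closed_SES P : mono_cokernel_closed P ->
  forall X Y Z, SES X Y Z -> P X -> P Y -> P Z.
Proof. by move=> H X Y Z [f [g /short_exactP/H]]. Qed.

(** * Objects with a resolution of bounded length *)

Section Dimension.
Variable P : set A.
Hypothesis Pthick : left_thick P.
Hypothesis Pcov : covers P.

Let Pext := let: And3 h _ _ := Pthick in extension_closed_SES h.
Let Pker := let: And3 _ _ h := Pthick in epi_kernel_closed_SES h.

(** A Schanuel argument without projectives: two covers of [M] are compared through their pullback.
    The syzygy claim at one length gives the extension claim at the next, which in turn gives the
    syzygy claim there. *)
Lemma res_syzygy_extension n :
  (forall M K X, res P n.+1 M -> SES K X M -> P X -> res P n K) /\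
  (forall K M X, res P n K -> SES K M X -> P X -> res P n M).
Proof.
elim: n => [|n [syz ext]].
  split=> [M K X [K0 [X0 [S0 PX0 PK0]]] S PX|K M X PK S PX];
    last exact: Pext S PK PX.
  have [E [S1 S2]] := SES_pullback S0 S.
  exact: Pker S2 (Pext S1 PK0 PX) PX0.
have ext' K M X : res P n.+1 K -> SES K M X -> P X -> res P n.+1 M.
  move=> rK S PX; have [L [V [S' PV]]] := Pcov M.
  have [E [S1 S2]] := SES_comp_epi S' S.
  exists L, V; split=> //.
  by apply: (syz _ _ _ rK S2); apply: Pker S1 PV PX.
split=> // M K X [K0 [X0 [S0 PX0 rK0]]] S PX.
(* [E], an extension of [X] by [K0], is covered by [V] with kernel [L]; the kernel [W] of [V ->> X0]
   then covers [K] with the same kernel. *)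
have [E [S1 S2]] := SES_pullback S0 S.
have [L [V [S3 PV rL]]] := ext' _ _ _ rK0 S1 PX.
have [W [S4 S5]] := SES_comp_epi S3 S2.
by exists L, W; split=> //; apply: Pker S4 PV PX0.
Qed.

Lemma res_syzygy n M K X : res P n.+1 M -> SES K X M -> P X -> res P n K.
Proof. by have [+ _] := res_syzygy_extension n; apply. Qed.

Lemma res_leq m n M : (m <= n)%N -> res P m M -> res P n M.
Proof.
move=> /subnK<-; elim: (n - m)%N => // k IH /IH {IH}.
rewrite addSn; elim: (k + m)%N M => {m n k} [M PM|n IH M [K [X [S PX rK]]]].
  (* The zero object lies in [P] as the kernel of the identity of [M]. *)
  have [O /(_ M)[S _]] := zero_SES; exists O, M; split=> //; exact: (Pker S).
by exists K, X; split=> //; apply: IH.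
Qed.

(** Covers need not lift along [Y ->> Z], so [Y] is covered through its pullback with [VZ]; [VX] is
    the kernel of the resulting epi onto [VZ]. *)
Lemma horseshoe X Y Z : SES X Y Z ->
  exists KX VX KY VY KZ VZ, [/\ SES KX VX X /\ P VX, SES KY VY Y /\ P VY,
    SES KZ VZ Z /\ P VZ & SES KX KY KZ].
Proof.
move=> S; have [KZ [VZ [SZ PVZ]]] := Pcov Z.
have [E [S1 S2]] := SES_pullback S SZ.
have [K [V [SE PV]]] := Pcov E.
have [VX [S3 S4]] := SES_comp_epi SE S1.
have [KY [S5 S6]] := SES_comp_epi SE S2.
exists K, VX, KY, V, KZ, VZ; split=> //; split=> //.
exact: Pker S3 PV PVZ.
Qed.

Lemma res_extension n X Y Z : SES X Y Z -> res P n X -> res P n Z -> res P n Y.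
Proof.
elim: n X Y Z => [|n IH] X Y Z S rX rZ; first exact: Pext S rX rZ.
have [KX [VX [KY [VY [KZ [VZ [[SX PX] [SY PY] [SZ PZ] SK]]]]]]] := horseshoe S.
exists KY, VY; split=> //; apply: IH SK _ _;
  [exact: res_syzygy rX SX PX|exact: res_syzygy rZ SZ PZ].
Qed.

Lemma res_epi_kernel n X Y Z : SES X Y Z -> res P n Y -> res P n Z -> res P n X.
Proof.
elim: n X Y Z => [|n IH] X Y Z S rY rZ; first exact: Pker S rY rZ.
have [KX [VX [KY [VY [KZ [VZ [[SX PX] [SY PY] [SZ PZ] SK]]]]]]] := horseshoe S.
exists KX, VX; split=> //; apply: IH SK _ _;
  [exact: res_syzygy rY SY PY|exact: res_syzygy rZ SZ PZ].
Qed.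

Lemma res_mono_cokernel n X Y Z :
  SES X Y Z -> res P n X -> res P n Y -> res P n.+1 Z.
Proof.
elim: n X Y Z => [|n IH] X Y Z S rX rY; first by exists X, Y.
have [KX [VX [KY [VY [KZ [VZ [[SX PX] [SY PY] [SZ PZ] SK]]]]]]] := horseshoe S.
exists KZ, VZ; split=> //; apply: IH SK _ _;
  [exact: res_syzygy rX SX PX|exact: res_syzygy rY SY PY].
Qed.

(** The sum of covers of [X] and [Y] covers [Z]. Its kernel is a syzygy of [Z] with the kernel over
    [X] as a summand, so induction applies. *)
Lemma res_summand n X Y Z (i : hom X Z) (j : hom Y Z) (p : hom Z X)
  (q : hom Z Y) : is_biproduct i j p q -> res P n Z -> res P n X.
Proof.
elim: n X Y Z i j p q => [|n IH] X Y Z i j p q B rZ.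
  by case: Pthick => _ + _; apply; eassumption.
have [K [V [S PV]]] := Pcov X; have [K' [V' [S' PV']]] := Pcov Y.
have [KK [iK [jK [pK [qK BK]]]]] := has_biproducts (abelianP A) K K'.
have [VV [iV [jV [pV [qV BV]]]]] := has_biproducts (abelianP A) V V'.
exists K, V; split=> //; apply: (IH _ _ _ _ _ _ _ BK).
apply: res_syzygy rZ (sum_SES BK BV B S S') _.
exact: Pext (biproduct_SES BV) PV PV'.
Qed.

End Dimension.

Lemma res_thick P : left_thick P -> covers P ->
  thick [set M | exists n, res P n M].
Proof.
move=> Pt Pc.
have ub m n M M' : res P m M -> res P n M' ->
    exists k, res P k M /\ res P k M'.
  move=> rM rM'; exists (maxn m n).
  by split; [apply: res_leq rM|apply: res_leq rM']; rewrite ?leq_maxl ?leq_maxr.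
split; split=> [X Y Z f g /short_exactP fg [m r1] [n r2]|X Y Z i j p q B [n r]|
    X Y Z f g /short_exactP fg [m r1] [n r2]]; try (
    have S : SES X Y Z by [exists f, g]; have [k [s1 s2]] := ub _ _ _ _ r1 r2).
- by exists k; apply: res_extension S _ _.
- by exists n; apply: res_summand B _.
- by exists k; apply: res_epi_kernel S _ _.
- by exists k; apply: res_extension S _ _.
- by exists n; apply: res_summand B _.
- by exists k.+1; apply: res_mono_cokernel S _ _.
Qed.

End Resolutions.

(** * Splicing *)

Section Splice.
Variable A : abelian_category.
Implicit Types X Y Z K E C M N W F : A.
Implicit Type P : set A.

(** [chain] grows at its left end, while syzygies are taken at the right end; this attaches
    [K >-> E ->> X] there. *)
Fixpoint splice n Y K E X {struct n} :
    chain n Y K -> hom K E -> hom E X -> chain n.+1 Y X :=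
  match n return chain n Y K -> hom K E -> hom E X -> chain n.+1 Y X with
  | 0 => fun d k g => existT _ E (k \oc d, g)
  | n'.+1 => fun d k g =>
      existT _ (projT1 d) ((projT2 d).1, splice (projT2 d).2 k g)
  end.

Lemma exact_after_splice n Z Y K E X (f : hom Z Y) (d : chain n Y K)
    (k : hom K E) (g : hom E X) :
  exact_after f d -> ses k g -> exact_after f (splice d k g).
Proof.
move=> fd kg; elim: n Z Y f d fd => [|n IH] Z Y f d [fd dx] /=; last first.
  by split=> //; apply: IH.
split; [|split; last exact: ses_epi kg].
  case: fd => I [e [m [ee mK fE]]]; exists I, e, m; split=> //.
  by apply/kernel_comp_mono => //; apply: ses_mono kg.
by exists K, d, k; split=> //; case: kg.
Qed.

Lemma exact_chain_splice n Y K E X (d : chain n Y K) (k : hom K E)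
    (g : hom E X) : exact_chain d -> ses k g -> exact_chain (splice d k g).
Proof.
case: n d => [|n] d [dm dx] kg; last first.
  by split=> //; apply: exact_after_splice.
split; first by apply: mono_comp dm; apply: ses_mono kg.
split; last exact: ses_epi kg.
by exists K, d, k; split=> //; case: kg.
Qed.

(** The cut is made at the image of the last map but one. *)
Lemma exact_after_unsplice n Z Y X (f : hom Z Y) (c : chain n.+1 Y X) :
    exact_after f c ->
  exists K E (d : chain n Y K) (k : hom K E) (g : hom E X),
    [/\ c = splice d k g, exact_after f d & ses k g].
Proof.
elim: n Z Y f c => [|n IH] Z Y f [E [u c]] [fu uc].
  case: uc => -[I [e [m [ee mK uE]]]] ce; simpl in *.
  exists I, E, e, m, c; split; [by rewrite uE| |exact: ses_intro_epi].
  split=> //; case: fu => I' [e' [m' [ee' mK' fE]]].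
  exists I', e', m'; split=> //; move: mK'; rewrite uE.
  by rewrite (kernel_comp_mono _ _ (kernel_mono mK)).
have [K [E' [d [k [g [cE ud kg]]]]]] := IH _ _ _ _ uc.
by exists K, E', (existT _ E (u, d)), k, g; split=> //=; rewrite -cE.
Qed.

Lemma exact_chain_unsplice n Y X (c : chain n.+1 Y X) : exact_chain c ->
  exists K E (d : chain n Y K) (k : hom K E) (g : hom E X),
    [/\ c = splice d k g, exact_chain d & ses k g].
Proof.
case: n c => [|n] [E [u c]] [um uc]; simpl in *.
  case: uc => -[I [e [m [ee mK uE]]]] ce.
  exists I, E, e, m, c; split; [by rewrite /= uE| |exact: ses_intro_epi].
  by split=> //; apply: (@mono_of_comp _ _ _ _ m); rewrite -uE.
have [K [E' [d [k [g [cE ud kg]]]]]] := exact_after_unsplice uc.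
by exists K, E', (existT _ E (u, d)), k, g; split=> //=; rewrite -cE.
Qed.

Lemma chain_in_splice P n Y K E X (d : chain n Y K) (k : hom K E)
    (g : hom E X) : chain_in P (splice d k g) <-> chain_in P d /\ P E.
Proof.
elim: n Y d => [|n IH] Y d /=; first by split=> [[]|[]].
case: (IH _ (projT2 d).2) => IH1 IH2.
by split=> [[? /IH1[]]|[[? ?] ?]]; [|split=> //; apply: IH2].
Qed.

Lemma chain_map_splice n Y Y' K E X (a : hom Y Y') (d : chain n Y K)
    (d' : chain n Y' K) (k : hom K E) (g : hom E X) :
  chain_map a d d' -> chain_map a (splice d k g) (splice d' k g).
Proof.
elim: n Y Y' a d d' => [|n IH] Y Y' a d d' /= => [->|[b [bd /IH]]].
  by exists (idm E); rewrite comp1m compm1 compA.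
by exists b.
Qed.

Lemma chain_map_splice2 n Y K E X E1 L E1' E' L' (d : chain n Y L)
    (k1 : hom L E1) (g1 : hom E1 K) (k : hom K E) (g : hom E X)
    (k1' : hom L E1') (g1' : hom E1' L') (k' : hom L' E') (g' : hom E' X)
    (a : hom E1' E1) (b : hom E' E) :
    a \oc k1' = k1 -> b \oc (k' \oc g1') = k \oc g1 \oc a -> g' = g \oc b ->
  chain_map (idm Y) (splice (splice d k1' g1') k' g')
                    (splice (splice d k1 g1) k g).
Proof.
move=> ak bkg gb; elim: n Y d => [|n IH] Y d /=.
  by exists a; split; [rewrite compA ak compm1|exists b].
by exists (idm _); rewrite comp1m compm1; split=> //; apply: IH.
Qed.

Lemma hatP P : iso_closed P -> hat P = [set M | exists n, res P n M].
Proof.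
move=> isoP; apply/seteqP; split=> M /=.
  move=> [n [Xn [c [cx PXn cP]]]]; exists n.
  elim: n M c cx cP => [|n IH] M c cx cP.
    (* In length 0 the chain is an isomorphism from [Xn] to [M], hence the need for closure under
       isomorphisms. *)
    by apply: isoP PXn; apply: (mono_epi_iso (f := c)); case: cx.
  have [K [E [d [k [g [cE dx kg]]]]]] := exact_chain_unsplice cx.
  move: cP; rewrite cE => /chain_in_splice[dP PE].
  by exists K, E; split=> //; [exists k, g|apply: IH dx dP].
move=> [n]; elim: n M => [|n IH] M /=.
  move=> PM; exists 0%N, M, (idm M); split=> //.
  by have iM := idm_iso M; split; [apply: iso_mono|apply: iso_epi].
move=> [K [E [[k [g kg]] PE /IH[m [Xm [d [dx PX dP]]]]]]].
exists m.+1, Xm, (splice d k g); split=> //; first exact: exact_chain_splice.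
exact/chain_in_splice.
Qed.

Lemma yoneda_splice n Y K E X (k : hom K E) (g : hom E X) (kg : ses k g)
    (d d' : extension n K Y) : yoneda_equiv d d' ->
  forall cP cP',
  @yoneda_equiv _ n.+1 X Y (exist _ (splice (sval d) k g) cP)
                           (exist _ (splice (sval d') k g) cP').
Proof.
pose S (d : extension n K Y) : extension n.+1 X Y :=
  exist _ _ (exact_chain_splice (svalP d) kg).
move=> dd' cP cP'; suff: yoneda_equiv (S d) (S d').
  by rewrite /S (Prop_irrelevance cP (exact_chain_splice (svalP d) kg))
    (Prop_irrelevance cP' (exact_chain_splice (svalP d') kg)).
elim: dd' => {d d' cP cP'} [d d' H|d|d d' _|d d' d'' _ H1 _ H2].
- exact/rst_step/chain_map_splice.
- exact: rst_refl.
- exact: rst_sym.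
- exact: rst_trans H1 H2.
Qed.

(* Any two [n.+1]-extensions of [X] by [Y] are refined by splices along a
   common extension [K >-> V ->> X] with [V], hence [K], in [P]. *)
Lemma Ext_zero_covers P Y : epi_kernel_closed P -> covers P ->
    (forall X, P X -> orth X Y) ->
  forall n X, (1 <= n)%N -> P X -> Ext_zero n X Y.
Proof.
move=> Pker Pcov PY [//|n] X _; elim: n X => [|n IH] X PX.
  exact/Ext1P/PY.
move=> [c cP] [c' cP'].
have [K [E [d [k [g [cE dx kg]]]]]] := exact_chain_unsplice cP.
have [K' [E' [d' [k' [g' [cE' dx' kg']]]]]] := exact_chain_unsplice cP'.
(* [Q] maps to both [E] and [E'], so a cover [V] of [Q] can replace both last terms. *)
have [Q [q [q' [[qq' _] q'e]]]] := pullback_epi_exists g' (ses_epi kg).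
have [_ [V [[_ [v /ses_epi ve]]] PV]] := Pcov Q.
have he : is_epi (g \oc (q \oc v)).
  by rewrite compA qq'; do 2!apply: epi_comp => //; apply: ses_epi kg'.
have [L [l lh]] := ses_of_epi he.
have PL : P L.
  by apply: (epi_kernel_closed_SES Pker _ PV PX); exists l, (g \oc (q \oc v)).
have refine (b : chain n.+2 Y X) (bP : exact_chain b) K1 E1
    (d1 : chain n.+1 Y K1) (k1 : hom K1 E1) (g1 : hom E1 X) (w : hom V E1) :
    b = splice d1 k1 g1 -> exact_chain d1 -> ses k1 g1 ->
    g1 \oc w = g \oc (q \oc v) ->
  exists (e : extension n.+1 L Y) eP, extension_map
    (exist _ (splice (sval e) l (g \oc (q \oc v))) eP : extension n.+2 X Y)
    (exist _ b bP).
  move=> bE d1x kg1 gw.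
  have [K0 [E0 [d0 [k0 [g0 [dE d0x kg0]]]]]] := exact_chain_unsplice d1x.
  (* [w] induces [u] from [L] to [K1]; pulling the last piece of [d1] back along [u] gives the
     refined extension. *)
  have [|u uE] := kernel_lift (g := w \oc l) (proj1 kg1).
    by rewrite compA gw (ses0 lh).
  have [E2 [a [g2 [k2 [[ga _] kg2 ak]]]]] := pullback_ses u kg0.
  exists (exist _ _ (exact_chain_splice d0x kg2)).
  exists (exact_chain_splice (exact_chain_splice d0x kg2) lh).
  rewrite /extension_map /= bE dE; apply: chain_map_splice2 ak _ (esym gw).
  by rewrite compA -uE -compA -ga compA.
have [e [eP ec]] := refine c cP _ _ _ _ _ _ cE dx kg erefl.
have gq' : g' \oc (q' \oc v) = g \oc (q \oc v) by rewrite !compA qq'.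
have [e' [eP' ec']] := refine c' cP' _ _ _ _ _ _ cE' dx' kg' gq'.
apply: rst_trans (rst_sym _ _ _ _ (rst_step _ _ _ _ ec)) _.
apply: rst_trans _ (rst_step _ _ _ _ ec').
by have := yoneda_splice lh (IH L PL e e') eP eP'.
Qed.

End Splice.

(** * Cotorsion pairs *)

Section Cotorsion.
Variable A : abelian_category.
Implicit Types X Y Z K E C M N W : A.
Implicit Types P Q w : set A.

Lemma split_summands P W E M : summand_closed P -> SES W E M -> orth M W ->
  P E -> P M /\ P W.
Proof.
move=> Ps [f [g fg]] MW PE; have [r rf] := MW _ _ _ _ fg (idm W).
have [s [gs rs frsg]] := ses_section fg rf.
have gf := ses0 fg.
split; first by apply: (Ps _ _ _ s f g r) PE; split=> //; rewrite addrC.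
by apply: (Ps _ _ _ f s r g) PE.
Qed.

(** Cover an extension [E] of [X] by [M] with [V] in [P]; the kernel [L] of [V ->> X] is in [P]. The
    map from [L] to [M] lifts to [W], then extends to [V]. Composed with [w] it kills the kernel of
    [V ->> E], so it descends to a retraction. *)
Lemma right_orth_mono_cokernel P : epi_kernel_closed P -> covers P ->
  forall K W M, SES K W M -> (forall X, P X -> orth X K) ->
  (forall X, P X -> orth X W) -> forall X, P X -> orth X M.
Proof.
move=> Pker Pcov K W M [k [w kw]] PK PW X PX.
apply: orth_retraction => E f g fg.
have [Y [V [[y [v yv]] PV]]] := Pcov E.
have [L [a [b [c [agv cb ac va]]]]] := ses_comp_epi yv fg.
have PL : P L.
  by apply: (epi_kernel_closed_SES Pker _ PV PX); exists a, (g \oc v).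
have [b' wb'] := orth_lift (PK L PL) kw b.
have [b'' b''a] := PW X PX _ _ _ _ agv b'.
have [|r rv] := cokernel_desc (g := w \oc b'') (proj2 yv).
  by rewrite -ac -compA (compA b'') b''a compA wb' (ses0 cb).
exists r; apply: (ses_epi cb).
by rewrite -compA -va compA rv -compA b''a wb' comp1m.
Qed.

Lemma cotorsion_left P Q : cotorsion_pair P Q ->
  forall X, P X <-> forall Y, Q Y -> orth X Y.
Proof.
move=> [_ PE] X; rewrite {1}PE.
by split=> H Y QY; [apply/Ext1P/H|apply/Ext1P/H].
Qed.

Lemma cotorsion_right P Q : cotorsion_pair P Q ->
  forall Y, Q Y <-> forall X, P X -> orth X Y.
Proof.
move=> [<- _] Y.
by split=> H X PX; [apply/Ext1P/H|apply/Ext1P/H].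
Qed.

Lemma hereditary_left_thick P Q : hereditary_cotorsion_pair P Q -> left_thick P.
Proof.
move=> [PQ Ext0]; have PE := cotorsion_left PQ; split.
- move=> X Y Z f g /short_exactP fg /PE PX /PE PZ; apply/PE => W QW.
  have S : SES X Y Z by exists f, g.
  by apply: orth_extension S _ _; [exact: PX|exact: PZ].
- move=> X Y Z i j p q [pi _ _ _ _] /PE PZ; apply/PE => W QW.
  by apply: orth_retract pi _; apply: PZ.
- move=> X Y Z f g /short_exactP fg /PE PY PZ; apply/PE => W QW.
  have S : SES X Y Z by exists f, g.
  by apply: epi_kernel_orth S _ _; [exact: PY|exact: Ext0].
Qed.

Lemma orth_of_Ext P w : Ext_orthogonal P w ->
  forall X W, P X -> w W -> orth X W.
Proof. by move=> H X W PX wW; apply/Ext1P/H. Qed.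

(** By induction [K] is in [X] and embeds into [W] in [w]. The pushout [E] is in [X], being an
    extension of [X'] by [X0], and contains [M] as a summand because [M] is orthogonal to [W]. *)
Lemma res_in_AB (P X w : set A) n M :
    left_thick X -> X `<=` P -> epi_kernel_closed P ->
    cogenerator w X -> (forall V W, P V -> w W -> orth V W) ->
  P M -> res X n M -> X M.
Proof.
move=> [/extension_closed_SES Xext Xsum _] XP /epi_kernel_closed_SES Pker.
move=> [_ Xcog] Pw; elim: n M => [//|n IH] M PM [K [X0 [S XX0 rK]]].
have XK : X K by apply: IH rK; apply: Pker S (XP _ XX0) PM.
have [W [X' [f [g [/short_exactP fg wW XX']]]]] := Xcog K XK.
have [|E [S1 S2]] := SES_pushout S (_ : SES K W X'); first by exists f, g.
by have [] := split_summands Xsum S1 (Pw _ _ PM wW) (Xext _ _ _ S2 XX0 XX').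
Qed.

Lemma AB_approximation P R w n M : extension_closed P -> cogenerator w P ->
    w `<=` R -> mono_cokernel_closed R -> res P n M ->
  (exists Y Z, [/\ SES Y Z M, P Z & R Y]) /\
  (exists Y Z, [/\ SES M Y Z, P Z & R Y]).
Proof.
move=> /extension_closed_SES Pext [_ Pcog] wR /mono_cokernel_closed_SES Rcok.
have Pcog' Z : P Z -> exists W Z', [/\ SES Z W Z', R W & P Z'].
  move=> /Pcog[W [Z' [f [g [/short_exactP fg /wR RW PZ']]]]].
  by exists W, Z'; split=> //; exists f, g.
elim: n M => [|n IH] M.
  move=> PM; have [W [Z' [S RW PZ']]] := Pcog' _ PM.
  split; last by exists W, Z'.
  have [O Oz] := zero_SES A; exists O, M; split=> //; first by have [] := Oz M.
  (* Zero lies in [R] as the cokernel of the identity of [W]. *)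
  by have [_ SW] := Oz W; apply: (Rcok _ _ _ SW).
move=> [K [G0 [S PG0 /IH[_ [Y [Z [S' PZ RY]]]]]]].
(* Pushing out along [K >-> Y] makes [E] an extension of [M] by [Y] and of [Z] by [G0]; the first is
   the left approximation of [M]. *)
have [E [S1 S2]] := SES_pushout S S'.
have PE : P E := Pext _ _ _ S2 PG0 PZ.
split; first by exists Y, E.
have [W [Z' [S3 RW PZ']]] := Pcog' _ PE.
(* With [E] embedded in [W], the right approximation of [M] is [V = W/Y]. *)
have [V [S4 S5]] := SES_comp_mono S3 S1.
by exists V, Z'; split=> //; apply: Rcok S4 RY RW.
Qed.

End Cotorsion.

(** * The Hovey triple attached to the AB-context *)

Theorem theorem5p5 (A : abelian_category) (X G Y H : set A)
    (isoX : iso_closed X) (isoG : iso_closed G)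
    (isoY : iso_closed Y) (isoH : iso_closed H)
    (XG : X `<=` G)
    (XYcomplete : complete_cotorsion_pair X Y)
    (XYhereditary : hereditary_cotorsion_pair X Y)
    (GH : left_AB_context G H (X `&` Y)) :
  hereditary_hovey_triple G (hat X) Y.
Proof.
have [XY approx] := XYcomplete.
have [[Gthick _ [_ [Gcog Gext0]]] hatG] := GH.
have [/= Gext Gsum Gker] := Gthick.
have Gw := orth_of_Ext Gext0.
have Xthick : left_thick X := hereditary_left_thick XYhereditary.
have [Xext Xsum Xker] := Xthick.
have XE := cotorsion_left XY; have YE := cotorsion_right XY.
have Xcov : covers X.
  move=> M; have [[Y0 [X0 [f [g [/short_exactP fg XX0 _]]]]] _] := approx M.
  by exists Y0, X0; split=> //; exists f, g.
have Gcov : covers G.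
  by move=> M; have [K [V [S /XG GV]]] := Xcov M; exists K, V.
have Ycok : mono_cokernel_closed Y.
  move=> K W M f g /short_exactP fg /YE XK /YE XW; apply/YE.
  by apply: (right_orth_mono_cokernel Xker Xcov _ XK XW); exists f, g.
have Yext V E W : SES V E W -> Y V -> Y W -> Y E.
  move=> S /YE XV /YE XW; apply/YE => Z XZ.
  by apply: (orth_extension_r S); [exact: XV|exact: XW].
have Xcog : cogenerator (X `&` Y) X.
  split=> [M []//|M XM].
  have [_ [Y0 [X0 [f [g [fg XX0 YY0]]]]]] := approx M.
  exists Y0, X0, f, g; split=> //; split=> //.
  exact: Xext fg XM XX0.
rewrite (hatP isoX); set W : set A := [set M | exists n, res X n M].
have [Wleft Wright] : thick W := res_thick Xthick Xcov.
have GW : G `&` W = X.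
  apply/seteqP; split=> M; last by move=> XM; split; [exact: XG|exists 0%N].
  by move=> [GM [n rM]]; apply: res_in_AB Gw GM rM.
(* Induction on the length: the kernel [K] of an [X]-cover of [M] is in [Y] and has a shorter
   resolution, while [X0], an extension of [M] by [K], is in the intersection of [X] and [Y]. *)
have GWY M : W M -> Y M -> forall Z, G Z -> orth Z M.
  move=> [n]; elim: n M => [|n IH] M.
    by move=> XM YM Z GZ; apply: Gw.
  move=> rM YM.
  have [[K [X0 [f [g [/short_exactP fg XX0 YK]]]]] _] := approx M.
  have S : SES K X0 M by exists f, g.
  have rK := res_syzygy Xthick Xcov rM S XX0.
  apply: (right_orth_mono_cokernel Gker Gcov S) (IH K rK YK) _ => Z GZ.
  by apply: Gw => //; split=> //; apply: Yext S YK YM.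
have WYcok : mono_cokernel_closed (W `&` Y).
  have [_ _ Wcok] := Wright.
  by move=> K V M f g fg [WK YK] [WV YV]; split;
    [apply: Wcok fg _ _|apply: Ycok fg _ _].
have wWY : X `&` Y `<=` W `&` Y by move=> M [XM YM]; split=> //; exists 0%N.
have Gapprox M : (exists V Z, [/\ SES V Z M, G Z & (W `&` Y) V]) /\
    (exists V Z, [/\ SES M V Z, G Z & (W `&` Y) V]).
  have [n rM] : [set M | exists n, res G n M] M by rewrite -hatP // hatG.
  exact: AB_approximation Gext Gcog wWY WYcok rM.
have GWYpair : cotorsion_pair G (W `&` Y).
  split; apply/seteqP; split=> M.
  - move=> GM; have oM Z : G Z -> orth Z M by move=> /GM/Ext1P.
    split; last by apply/YE => Z /XG/oM.
    (* The right approximation of [M] splits, so [M] is a summand of [V] in [W]. *)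
    have [_ [V [Z [S GZ [WV _]]]]] := Gapprox M.
    have [_ Wsum _] := Wleft.
    by have [] := split_summands Wsum S (oM _ GZ) WV.
  - by move=> [WM YM] Z GZ; apply/Ext1P/GWY.
  - by move=> GM V [WV YV]; apply/Ext1P/GWY.
  (* Here the left approximation splits, and [M] is a summand of [Z] in [G]. *)
  - move=> oM; have [[V [Z [S GZ WYV]]] _] := Gapprox M.
    by have [] := split_summands Gsum S ((Ext1P _ _).1 (oM _ WYV)) GZ.
have GWYhereditary : hereditary_cotorsion_pair G (W `&` Y).
  split=> // Z M i GZ [WM YM] i1.
  by apply: Ext_zero_covers Gker Gcov (GWY M WM YM) _ _ i1 GZ.
split; rewrite ?GW //; split; rewrite ?GW //.
split=> // M; have [[V [Z [[f [g fg]] GZ WYV]]]] := Gapprox M.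
move=> [V' [Z' [[f' [g' fg']] GZ' WYV']]].
split; first by exists V, Z, f, g; split=> //; apply/short_exactP.
by exists V', Z', f', g'; split=> //; apply/short_exactP.
Qed.
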